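(* Let $X$ and $Y$ be complex normed spaces with $\dim(X)\geq 2$, and assume that $X$ admits a conjugation $\tau$. Let $A: X\to Y$ be an additive mapping preserving Birkhoff orthogonality. Then $A$ is real-linear. Furthermore, if $A$ is surjective and preserves Birkhoff orthogonality in both directions, then $A$ is a real-linear isomorphism and the underlying real normed spaces $X_{\mathbb{R}}$ and $Y_{\mathbb{R}}$ are isomorphic.
   Context: A conjugation on a complex normed space $X$ is a conjugate-linear isometry $\tau:X\to X$ of period $2$ (i.e. $\tau(\tau(x))=x$ for all $x\in X$). $\dim(X)$ is the dimension of $X$ as a complex vector space. For elements $x,y$ of a complex normed space, $x$ is Birkhoff (or Birkhoff-James) orthogonal to $y$, written $x\perp_B y$, if $\|x\|\leq\|x+\alpha y\|$ for all $\alpha\in\mathbb{C}$. A mapping $A:X\to Y$ preserves Birkhoff orthogonality if for all $x,y\in X$, $x\perp_B y$ implies $A(x)\perp_B A(y)$; it preserves Birkhoff orthogonality in both directions if for all $x,y\in X$, $x\perp_B y$ if and only if $A(x)\perp_B A(y)$. $A$ is additive if $A(x+y)=A(x)+A(y)$ for all $x,y\in X$. $X_{\mathbb{R}}$ and $Y_{\mathbb{R}}$ denote $X$ and $Y$ regarded as real normed spaces (same norm, scalars restricted to $\mathbb{R}$). Isomorphism is meant in the sense of (real) normed spaces: a real-linear bijection which is continuous with continuous inverse. *)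

(* Defs.v *)
From HB Require Import structures.
From mathcomp Require Export all_boot all_order all_algebra.
From mathcomp Require Export all_classical all_reals all_analysis.
From mathcomp Require Export complex.

Set Implicit Arguments.
Unset Strict Implicit.
Unset Printing Implicit Defensive.

Import Order.TTheory GRing.Theory Num.Theory.
Import numFieldNormedType.Exports.

Local Open Scope ring_scope.
Local Open Scope complex_scope.

(* [X] may be infinite-dimensional, so [dim X >= n] is expressed by the
   existence of [n] linearly independent vectors. *)
Definition linearly_independent (K : fieldType) (V : lmodType K) (n : nat)
    (v : 'I_n -> V) : Prop :=
  forall c : 'I_n -> K, \sum_(i < n) c i *: v i = 0 -> forall i, c i = 0.

Definition dim_ge (K : fieldType) (V : lmodType K) (n : nat) : Prop :=
  exists v : 'I_n -> V, linearly_independent v.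

Section ComplexNormedSpaces.
Variable R : realType.

Definition conjugation (X : normedModType R[i]) (tau : X -> X) : Prop :=
  [/\ forall x y, tau (x + y) = tau x + tau y,
      forall (a : R[i]) x, tau (a *: x) = a^* *: tau x,
      forall x, `|tau x| = `|x|
    & forall x, tau (tau x) = x].

(* Norms on a [normedModType R[i]] take values in [R[i]]; they are nonnegative
   reals there, on which the order of [R[i]] is that of [R]. *)
Definition birkhoff_orthogonal (X : normedModType R[i]) (x y : X) : Prop :=
  forall a : R[i], `|x| <= `|x + a *: y|.

Definition preserves_birkhoff (X Y : normedModType R[i]) (A : X -> Y) : Prop :=
  forall x y, birkhoff_orthogonal x y -> birkhoff_orthogonal (A x) (A y).

Definition preserves_birkhoff_both (X Y : normedModType R[i]) (A : X -> Y) :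
    Prop :=
  forall x y, birkhoff_orthogonal x y <-> birkhoff_orthogonal (A x) (A y).

Definition additive_map (U V : zmodType) (A : U -> V) : Prop :=
  forall x y, A (x + y) = A x + A y.

Definition surjective_map (U V : Type) (A : U -> V) : Prop :=
  forall y, exists x, A x = y.

End ComplexNormedSpaces.

Definition realification (R : realType) (X : normedModType R[i]) : Type := X.

Section Realification.
Variables (R : realType) (X : normedModType R[i]).

HB.instance Definition _ := GRing.Zmodule.copy (realification X) X.

Definition real_scale (a : R) (x : realification X) : realification X :=
  a%:C *: (x : X).

Fact real_scaleA a b x : real_scale a (real_scale b x) = real_scale (a * b) x.
Proof. by rewrite /real_scale scalerA rmorphM. Qed.

Fact real_scale1 : left_id 1 real_scale.
Proof. by move=> x; rewrite /real_scale rmorph1 scale1r. Qed.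

Fact real_scaleDr : right_distributive real_scale +%R.
Proof. by move=> a x y; rewrite /real_scale scalerDr. Qed.

Fact real_scaleDl x : {morph real_scale^~ x : a b / a + b}.
Proof. by move=> a b; rewrite /real_scale rmorphD scalerDl. Qed.

HB.instance Definition _ := GRing.Zmodule_isLmodule.Build R (realification X)
  real_scaleA real_scale1 real_scaleDr real_scaleDl.

Definition real_norm (x : realification X) : R := complex.Re `|(x : X)|.

Fact real_normE (x : X) : (real_norm x)%:C = `|x|.
Proof. by rewrite /real_norm RRe_real ?normr_real. Qed.

Fact real_normD x y : real_norm (x + y) <= real_norm x + real_norm y.
Proof. by rewrite -lecR rmorphD /= !real_normE ler_normD. Qed.

Fact real_normZ (a : R) x : real_norm (a *: x) = `|a| * real_norm x.
Proof.
apply: complexI; rewrite rmorphM /= !real_normE normrZ normc_def /=.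
by rewrite expr0n addr0 sqrtr_sqr.
Qed.

Fact real_norm_eq0 x : real_norm x = 0 -> x = 0.
Proof. by move=> x0; apply/(@normr0_eq0 _ X); rewrite -real_normE x0. Qed.

HB.instance Definition _ := Lmodule_isNormed.Build R (realification X)
  real_normD real_normZ real_norm_eq0.

End Realification.

Lemma realification_scaleE (R : realType) (X : normedModType R[i]) (a : R)
    (x : X) : a *: (x : realification X) = a%:C *: x.
Proof. by []. Qed.

Lemma realification_normE (R : realType) (X : normedModType R[i]) (x : X) :
  `|(x : realification X)|%:C = `|x|.
Proof. exact: real_normE. Qed.

Section Isomorphisms.
Variable R : realType.

Definition real_linear (X Y : normedModType R[i]) (A : X -> Y) : Prop :=
  linear (A : realification X -> realification Y).

Definition isomorphism (V W : normedModType R) (f : V -> W) : Prop :=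
  [/\ linear f, continuous f
    & exists g : W -> V, [/\ cancel f g, cancel g f & continuous g]].

Definition isomorphic (V W : normedModType R) : Prop :=
  exists f : V -> W, isomorphism f.

Definition real_linear_isomorphism (X Y : normedModType R[i]) (A : X -> Y) :
    Prop :=
  isomorphism (A : realification X -> realification Y).

End Isomorphisms.

(* Main.v *)
From HB Require Import structures.
Require Import Defs.
From mathcomp Require Import all_boot all_order all_algebra.
From mathcomp Require Import all_classical all_reals all_analysis.
From mathcomp Require Import complex.
From mathcomp Require Import ring lra.

Local Open Scope ring_scope.
Local Open Scope complex_scope.

Set Implicit Arguments.
Unset Strict Implicit.
Unset Printing Implicit Defensive.

Import Order.TTheory GRing.Theory Num.Theory.
Import numFieldNormedType.Exports.

(** The conjugation splits [X] as [S + iS], where [S] is the real space of its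
    fixed points.  For [x, y] in [S] complex orthogonality is the same as real
    orthogonality, because the real part [(z + tau z) / 2] of [z] has norm at
    most [`|z|].  So the theorem rests on real Birkhoff orthogonality in [S],
    applied to all the maps [x |-> A (a x)], [a] complex: each of them is
    additive and sends real orthogonal pairs of [S] to orthogonal pairs.

    Everything about such a map, again called [A], comes from one remark
    ([birkhoff_foot_norm_le]): if [x] is a point nearest to the origin on a
    line through [y], that is, if [x] is orthogonal to [y - x], then
    [`|A x| <= `|A y|].

    - Homogeneity ([additive_birkhoff_homogeneous]).  Let [x] be orthogonal to
      [y] with equal norms.  For every small [c > 0] there is a [w = x + t y]
      orthogonal to [y - c w] ([real_birkhoff_log_slope]).  Then [c x] is a
      nearest point on a line through [c w], and [c w] on a line through [y],
      so [`|A (c x)| <= `|A y|].  Hence [r |-> A (r x)] is additive and bounded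
      on an interval, which makes it linear.  Since [A] is real-linear on [S]
      and on [iS], it is real-linear.

    - Comparability ([additive_birkhoff_comparable]).  Between two vectors of
      [S] of the same norm there is a chain of at most two such comparisons in
      which only a bounded factor is lost, so [`|A x|] and [`|A y|] agree up to
      the factor 12.  This bounds [A] on [S] and on [iS], hence on [X].

    - Lower bound ([additive_birkhoff_re_bound]).  Let [z = x + i y] with
      [x, y] in [S], and choose a real [s] such that [x] is orthogonal to
      [w = y - s x].  Then [z = (1 + i s) x + i w], the two terms are
      orthogonal, and so [`|A ((1 + i s) x)| <= `|A z|].  By comparability, the
      left-hand side may be estimated at one fixed vector [x0] of [S], where
      the points [A x0 + s A (i x0)] run through a line that avoids the origin
      as soon as [A] is injective.  The same argument for [x |-> A (i x)] at
      the point [- i z = y - i x] controls [`|y|]. *)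

(** * Birkhoff orthogonality in real normed spaces *)

Section RealOrthogonality.
Variables (R : realType) (V : normedModType R).
Implicit Types (x y v w : V) (s t : R).

Definition real_birkhoff x y : Prop := forall t, `|x| <= `|x + t *: y|.

Lemma real_birkhoffZ s t x y :
  real_birkhoff x y -> real_birkhoff (s *: x) (t *: y).
Proof.
move=> xy u; have [->|s0] := eqVneq s 0; first by rewrite scale0r normr0.
have -> : s *: x + u *: (t *: y) = s *: (x + (u * t / s) *: y).
  by rewrite scalerDr !scalerA (mulrC s) divfK.
by rewrite !normrZ ler_wpM2l.
Qed.

(** Orthogonality of [x] to [y - s x] says that [s] is a subgradient at [0] of
    [t |-> `|x + t y| / `|x|].  By convexity it is enough to check the
    subgradient inequality near [0]. *)
Lemma real_birkhoff_of_support (d : R) s x y : 0 < d ->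
  (forall t, `|t| <= d -> `|x| * (1 + s * t) <= `|x + t *: y|) ->
  real_birkhoff x (y - s *: x).
Proof.
move=> d0 supp t; set v := y - s *: x.
(* small enough for the factor [1 - e t s] below to be at least 1/2 and for the
   rescaled parameter [e t / (1 - e t s)] to stay in [-d, d] *)
pose e := (1 + 2 * `|t| * `|s| + 2 * `|t| / d)^-1.
have q0 : 0 < 1 + 2 * `|t| * `|s| + 2 * `|t| / d.
  by rewrite -addrA ltr_pwDl// addr_ge0 ?divr_ge0 ?mulr_ge0// ltW.
have e0 : 0 < e by rewrite invr_gt0.
have e1 : e + 2 * `|e * t| * `|s| + 2 * `|e * t| / d = 1.
  by rewrite normrM (gtr0_norm e0) -[RHS](mulVf (lt0r_neq0 q0)) -/e; ring.
have ts0 : 0 <= 2 * `|e * t| * `|s| by rewrite !mulr_ge0.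
have td0 : 0 <= 2 * `|e * t| / d by rewrite divr_ge0 ?mulr_ge0// ltW.
have es : `|e * t * s| <= 1 / 2.
  by rewrite [X in X <= _]normrM; lra.
have ed : 2 * `|e * t| <= d.
  by rewrite -[leRHS]mul1r -ler_pdivrMr//; lra.
have p2 : 1 / 2 <= 1 - e * t * s by have := ler_norm (e * t * s); lra.
have p0 : 0 < 1 - e * t * s by lra.
have near : `|x| <= `|x + (e * t) *: v|.
  have -> : x + (e * t) *: v
      = (1 - e * t * s) *: (x + (e * t / (1 - e * t * s)) *: y).
    rewrite [RHS]scalerDr scalerA (mulrC (1 - _)) divfK ?gt_eqF// /v scalerBr.
    by rewrite scalerBl scale1r scalerA addrAC addrA.
  rewrite normrZ gtr0_norm//.
  apply: (le_trans _ (ler_wpM2l (ltW p0) (supp _ _))); last first.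
    rewrite normf_div (gtr0_norm p0) ler_pdivrMr//.
    by apply: (le_trans _ (ler_wpM2l (ltW d0) p2)); lra.
  by rewrite le_eqVlt; apply/orP; left; apply/eqP; field; rewrite gt_eqF.
clearbody v.
(* a local minimum of the convex function on the line is a global one *)
have : `|x| <= (1 - e) * `|x| + e * `|x + t *: v|.
  apply: (le_trans near).
  have -> : x + (e * t) *: v = (1 - e) *: x + e *: (x + t *: v).
    by rewrite scalerBl scale1r scalerDr scalerA addrA subrK.
  apply: (le_trans (ler_normD _ _)).
  by rewrite !normrZ (gtr0_norm e0) ger0_norm//; lra.
by move=> h; rewrite -(ler_pM2l e0); lra.
Qed.

(** A convex function on the line has a subgradient: the supremum of its left
    difference quotients is at most each right one. *)
Lemma real_birkhoff_exists x y : exists s, real_birkhoff x (y - s *: x).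
Proof.
have [->|x0] := eqVneq x 0; first by exists 0 => t; rewrite normr0.
have nx0 : 0 < `|x| by rewrite normr_gt0.
pose E : set R := [set (`|x| - `|x - t *: y|) / t | t in [set t | 0 < t]]%classic.
have ub u : 0 < u -> ubound E ((`|x + u *: y| - `|x|) / u).
  move=> u0 _ [t /= t0 <-].
  rewrite ler_pdivrMr// mulrAC ler_pdivlMr//.
  have : `|(t + u) *: x| <= `|t *: (x + u *: y)| + `|u *: (x - t *: y)|.
    have -> : (t + u) *: x = t *: (x + u *: y) + u *: (x - t *: y).
      rewrite scalerDr scalerBr !scalerA (mulrC u t) scalerDl.
      by rewrite addrACA subrr addr0.
    exact: ler_normD.
  rewrite !normrZ !gtr0_norm ?addr_gt0//; lra.
exists (sup E / `|x|); apply: (@real_birkhoff_of_support 1) => // t _.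
have -> : `|x| * (1 + sup E / `|x| * t) = `|x| + sup E * t.
  by field; rewrite gt_eqF.
have E0 : (E !=set0)%classic by exists ((`|x| - `|x - 1 *: y|) / 1); exists 1 => /=.
have [t0|t0|->] := ltgtP t 0; last by rewrite mulr0 addr0 scale0r addr0.
- have : (`|x| - `|x + t *: y|) / (- t) <= sup E.
    apply: ub_le_sup; first by eexists; exact: (ub 1).
    by exists (- t); rewrite /= ?oppr_gt0// scaleNr opprK.
  by rewrite ler_pdivrMr ?oppr_gt0//; lra.
- have := ge_sup E0 (ub t t0).
  by rewrite ler_pdivlMr//; lra.
Qed.

(** The conclusion says that [c] is a logarithmic subgradient at [t] of the
    function [u |-> `|x + u y|], i.e. that [t] is a critical point of
    [`|x + u y| exp (- c u)].  A minimum of the latter on [-1, 4] is interior: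
    it is not at [-1], where orthogonality gives a value larger than the one at
    [0], nor at [4], where the norm has at least tripled and the exponential is
    at least 1/2.  The bound on [c] only serves this last estimate. *)
Lemma real_birkhoff_log_slope c x y : real_birkhoff x y -> `|y| = `|x| ->
  x != 0 -> 0 < c -> c <= 1 / 8 ->
  exists t, real_birkhoff (x + t *: y) (y - c *: (x + t *: y)).
Proof.
move=> xy yx x0 c0 c8.
have nx0 : 0 < `|x| by rewrite normr_gt0.
pose psi t := `|x + t *: y| * expR (- (c * t)).
have cpsi : continuous psi.
  move=> t; apply: cvgM.
    apply: cvg_norm; apply: cvgD; first exact: cvg_cst.
    by apply: cvgZr_tmp; exact: cvg_id.
  apply: continuous_comp; last exact: continuous_expR.
  by apply: cvgN; apply: cvgMl_tmp; exact: cvg_id.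
have [||t0 t0I t0min] := @EVT_min R psi (-1) 4; first lra.
  exact: continuous_subspaceT.
have psi0 : psi t0 <= `|x|.
  have := t0min 0; rewrite /psi mulr0 oppr0 expR0 mulr1 scale0r addr0; apply.
  by rewrite in_itv/=; lra.
have t0N1 : -1 < t0.
  rewrite lt_neqAle; move: t0I; rewrite in_itv/= => /andP[-> _]; rewrite andbT.
  apply/eqP => t0E; move: psi0; rewrite -t0E /psi.
  rewrite mulrN1 opprK => le1.
  have := le_trans (ler_pM (normr_ge0 _) _ (xy (-1)) (expR_ge1Dx c)) le1.
  have := mulr_gt0 nx0 c0; lra.
have t04 : t0 < 4.
  rewrite lt_neqAle; move: t0I; rewrite in_itv/= => /andP[_ ->]; rewrite andbT.
  apply/eqP => t0E; move: psi0; rewrite t0E /psi => le1.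
  have n4 : 3 * `|x| <= `|x + 4 *: y|.
    have := ler_normB (x + 4 *: y) x.
    by rewrite addrAC subrr add0r normrZ yx ger0_norm//; lra.
  have e4 : 1 / 2 <= expR (- (c * 4)).
    by apply: le_trans (expR_ge1Dx _); lra.
  have := le_trans (ler_pM _ _ n4 e4) le1; lra.
exists t0; apply: (@real_birkhoff_of_support (Num.min (t0 + 1) (4 - t0))).
  by rewrite lt_min; lra.
move=> t; rewrite le_min ler_norml ler_norml => tI.
have : psi t0 <= psi (t0 + t) by apply: t0min; rewrite in_itv/=; lra.
rewrite /psi mulrDr opprD expRD mulrA mulrAC ler_pM2r ?expR_gt0// expRN.
rewrite ler_pdivlMr ?expR_gt0// scalerDl addrA; apply: le_trans.
by rewrite ler_wpM2l// expR_ge1Dx.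
Qed.

(** A line that avoids the origin stays at a positive distance from it; the
    distance is estimated after moving the base point [y] to a [w] to which
    the direction is orthogonal, for then [`|t x| <= `|w + t x|]. *)
Lemma line_norm_ge x y : (forall s, y <> s *: x) ->
  exists2 c, 0 < c & forall s, c <= `|y + s *: x|.
Proof.
move=> indep; have [s0 orth] := real_birkhoff_exists x y.
set w := y - s0 *: x in orth.
have w0 : 0 < `|w| by rewrite normr_gt0 subr_eq0; apply/eqP/indep.
exists (`|w| / 2) => [|s]; first by rewrite divr_gt0.
have -> : y + s *: x = w + (s + s0) *: x by rewrite scalerDl addrCA subrK addrC.
move: (s + s0) => t.
have [->|t0] := eqVneq t 0; first by rewrite scale0r addr0; lra.
have tx : `|t *: x| <= `|w + t *: x|.
  by have := real_birkhoffZ t 1 orth 1; rewrite !scale1r addrC.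
have := ler_normB (w + t *: x) (t *: x); rewrite addrK; lra.
Qed.

End RealOrthogonality.

(** * Additive maps preserving real orthogonality *)

(** The defect [g t = f t - t f 1] is additive and vanishes on the integers, so
    its values are those taken on [0, 1), which are bounded; and a bounded
    additive function is zero. *)
Lemma bounded_additive_linear (R : realType) (W : normedModType R)
    (f : {additive R -> W}) (d M : R) :
  0 < d -> (forall t, 0 < t -> t <= d -> `|f t| <= M) ->
  forall r, f r = r *: f 1.
Proof.
move=> d0 fM r; apply/eqP; rewrite -subr_eq0 -normr_eq0; apply/negPn/negP => g0.
pose g t := f t - t *: f 1.
have gz (z : int) t : g (t + z%:~R) = g t.
  rewrite /g raddfD scalerDl opprD addrACA.
  by rewrite -[in f z%:~R]/(1 *~ z) raddfMz -scaler_int subrr addr0.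
have gn n t : g (t *+ n) = g t *+ n by rewrite /g raddfMn -scalerMnl -mulrnBl.
have M0 : 0 <= M by apply: le_trans (fM d _ _).
pose N := (Num.Def.archi_bound d^-1).+1.
have Nd : N%:R^-1 <= d.
  rewrite invf_ple ?posrE// ltW// (lt_trans (archi_boundP _)) ?invr_ge0 ?ltW//.
  by rewrite ltr_nat.
pose K := M *+ N + `|f 1|.
have gK t : `|g t| <= K.
  set u := t - (Num.Def.floor t)%:~R.
  have -> : g t = g u by rewrite -(gz (Num.Def.floor t) u) subrK.
  have /andP[u0 u1] : 0 <= u < 1.
    have := floor_itv t; rewrite intrD /u => /andP[??]; lra.
  apply: (le_trans (ler_normB _ _)); apply: lerD; last first.
    by rewrite normrZ ger0_norm// ler_piMl// ltW.
  have -> : u = u / N%:R *+ N by rewrite -mulr_natr divfK// pnatr_eq0.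
  rewrite raddfMn normrMn lerMn2r; apply/orP; right.
  move: u0; rewrite le_eqVlt => /predU1P[<-|u0].
    by rewrite mul0r raddf0 normr0.
  apply: fM; first by rewrite divr_gt0// ltr0n.
  by apply: le_trans Nd; rewrite ler_piMl// ?invr_ge0 ?ltW.
have gr0 : 0 < `|g r| by rewrite lt_neqAle eq_sym g0 normr_ge0.
have := gK (r *+ Num.Def.archi_bound (K / `|g r|)).
rewrite gn normrMn -mulr_natl -ler_pdivlMr// leNgt archi_boundP//.
by rewrite divr_ge0// (le_trans _ (gK 0)).
Qed.

Section BirkhoffPreservers.
Variables (R : realType) (V W : normedModType R) (S : V -> Prop).
Hypotheses (S_add : forall x y, S x -> S y -> S (x + y))
  (S_scale : forall a x, S x -> S (a *: x)).
Variable A : {additive V -> W}.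
Hypothesis A_birkhoff :
  forall x y, S x -> S y -> real_birkhoff x y -> real_birkhoff (A x) (A y).

Let S_sub x y : S x -> S y -> S (x - y).
Proof. by move=> Sx Sy; rewrite -scaleN1r; apply/S_add/S_scale. Qed.

(** The only way in which orthogonality enters below: the hypothesis makes [x] a
    nearest point to the origin on the line through [x] and [y]. *)
Lemma birkhoff_foot_norm_le x y : S x -> S y ->
  real_birkhoff x (y - x) -> `|A x| <= `|A y|.
Proof.
move=> Sx Sy /(A_birkhoff Sx (S_sub Sy Sx))/(_ 1).
by rewrite scale1r -raddfD addrC subrK.
Qed.

Hypothesis S_dim : forall x, S x -> exists2 y, S y & forall r, y <> r *: x.

(** In a one-dimensional space every pair of orthogonal vectors contains [0] and
    nothing can be said; the second direction is what provides a [y] such that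
    [`|A (c x)| <= `|A (c w)| <= `|A y|] for all small [c]. *)
Lemma additive_birkhoff_homogeneous r x : S x -> A (r *: x) = r *: A x.
Proof.
move=> Sx; have [->|x0] := eqVneq x 0; first by rewrite scaler0 raddf0 scaler0.
have nx0 : 0 < `|x| by rewrite normr_gt0.
have [y' Sy' xy'] := S_dim Sx; have [s xs] := real_birkhoff_exists x y'.
set y1 := y' - s *: x in xs.
have y10 : 0 < `|y1| by rewrite normr_gt0 subr_eq0; apply/eqP.
pose y := (`|x| / `|y1|) *: y1.
have Sy : S y by apply/S_scale/S_sub/S_scale.
have xy : real_birkhoff x y.
  by have := real_birkhoffZ 1 (`|x| / `|y1|) xs; rewrite scale1r.
have yx : `|y| = `|x|.
  by rewrite normrZ normf_div !normr_id divfK// gt_eqF.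
pose f0 t := A (t *: x).
have f0B : zmod_morphism f0 by move=> t u; rewrite /f0 scalerBl raddfB.
pose f : {additive R -> W} := HB.pack f0 (GRing.isZmodMorphism.Build _ _ _ f0B).
have := @bounded_additive_linear _ _ f (1 / 8) `|A y|; rewrite /= /f0 scale1r.
apply => [|c c0 c8]; first by [].
have [t wy] := real_birkhoff_log_slope xy yx x0 c0 c8.
set w := x + t *: y in wy.
have Sw : S w by apply/S_add/S_scale.
apply: (@le_trans _ _ `|A (c *: w)|).
  apply: birkhoff_foot_norm_le; rewrite ?/w; try exact: S_scale.
  by rewrite scalerDr addrAC subrr add0r scalerA; apply: real_birkhoffZ.
apply: birkhoff_foot_norm_le => //; first exact: S_scale.
by have := real_birkhoffZ c 1 wy; rewrite scale1r.
Qed.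

Let A_scale := additive_birkhoff_homogeneous.

Lemma birkhoff_foot_norm_leZ s x y : S x -> S y ->
  real_birkhoff x (y - s *: x) -> `|s| * `|A x| <= `|A y|.
Proof.
move=> Sx Sy xy; rewrite -normrZ -A_scale//.
apply: birkhoff_foot_norm_le => //; first exact: S_scale.
by have := real_birkhoffZ s 1 xy; rewrite scale1r.
Qed.

(** If [x] is orthogonal to [y - s x] then [`|s| `|A x| <= `|A y|], which is
    enough unless [s] is small.  In that case pass through [z = x + 3 y]: [x] is
    orthogonal to [z - (1 + 3 s) x], and [z] is long enough compared with [x]
    for its foot [g z] on a line through [y] to have [g >= 1/6]. *)
Lemma additive_birkhoff_norm_comparable x y : S x -> S y -> `|x| = `|y| ->
  `|A x| <= 12 * `|A y|.
Proof.
move=> Sx Sy nxy; have [->|x0] := eqVneq x 0.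
  by rewrite raddf0 normr0 mulr_ge0.
have nx0 : 0 < `|x| by rewrite normr_gt0.
have [s xs] := real_birkhoff_exists x y.
have Axs := birkhoff_foot_norm_leZ Sx Sy xs.
have [s6|s6] := leP (1 / 6) `|s|.
  have := ler_wpM2r (normr_ge0 (A x)) s6; have := normr_ge0 (A y); lra.
pose z := x + 3 *: y.
have Sz : S z by apply/S_add/S_scale.
have xz : `|1 + 3 * s| * `|A x| <= `|A z|.
  apply: birkhoff_foot_norm_leZ => //.
  have -> : z - (1 + 3 * s) *: x = 3 *: (y - s *: x).
    by rewrite /z scalerDl scale1r scalerBr scalerA opprD addrA [x + _]addrC addrK.
  by have := real_birkhoffZ 1 3 xs; rewrite scale1r.
have [g zg] := real_birkhoff_exists z y.
have zy := birkhoff_foot_norm_leZ Sz Sy zg.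
have nz : 2 * `|x| <= `|z|.
  have := ler_normB z x; rewrite /z addrAC subrr add0r normrZ ger0_norm//.
  by rewrite -nxy; lra.
have g1 : `|1 - 3 * g| * `|z| <= `|x|.
  have := real_birkhoffZ (1 - 3 * g) (- 3) zg 1.
  rewrite scale1r normrZ; congr (_ <= `|_|).
  rewrite scalerBl scale1r scaleNr scalerBr scalerA opprB addrA subrK.
  by rewrite /z addrK.
have g6 : 1 / 6 <= g.
  have : `|1 - 3 * g| <= 1 / 2.
    have nz0 : 0 < `|z| by lra.
    by rewrite -(ler_pM2r nz0); lra.
  by rewrite ler_norml; lra.
have s1 : 1 / 2 <= `|1 + 3 * s|.
  by have := ler_norm (1 + 3 * s); move: s6; rewrite ltr_norml; lra.
have := ler_wpM2r (normr_ge0 (A x)) s1.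
have := ler_wpM2r (normr_ge0 (A z)) (le_trans g6 (ler_norm g)).
lra.
Qed.

Lemma additive_birkhoff_comparable x y : S x -> S y ->
  `|A x| * `|y| <= 12 * (`|A y| * `|x|).
Proof.
move=> Sx Sy; have [->|x0] := eqVneq x 0.
  by rewrite raddf0 !normr0 mul0r !mulr0.
have nx0 : 0 < `|x| by rewrite normr_gt0.
have := @additive_birkhoff_norm_comparable ((`|y| / `|x|) *: x) y.
rewrite A_scale// !normrZ normfV !normr_id divfK ?gt_eqF//.
move=> /(_ (S_scale _ Sx) Sy erefl); rewrite mulrAC ler_pdivrMr//; lra.
Qed.

End BirkhoffPreservers.


(** * The real part of a complex normed space with a conjugation *)

Section ComplexNorm.
Variables (R : realType) (X : normedModType R[i]).
Local Notation XR := (realification X).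
Implicit Types x y : X.

Lemma birkhoff_orthogonalZ (a b : R[i]) x y :
  birkhoff_orthogonal x y -> birkhoff_orthogonal (a *: x) (b *: y).
Proof.
move=> xy u; have [->|a0] := eqVneq a 0; first by rewrite scale0r normr0.
have -> : a *: x + u *: (b *: y) = a *: (x + (u * b / a) *: y).
  by rewrite scalerDr !scalerA (mulrC a) divfK.
by rewrite !normrZ ler_wpM2l.
Qed.

Lemma birkhoff_orthogonal_real x y :
  birkhoff_orthogonal x y -> real_birkhoff (x : XR) (y : XR).
Proof. by move=> xy t; rewrite -lecR !realification_normE; apply: xy. Qed.

Lemma birkhoff_norm_le x y : birkhoff_orthogonal x y ->
  `|x : XR| <= `|x + y : XR|.
Proof. by move=> /birkhoff_orthogonal_real/(_ 1); rewrite scale1r. Qed.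

Lemma realification_normZ (a : R[i]) x :
  `|a *: x : XR| = complex.Re `|a| * `|x : XR|.
Proof.
apply: complexI; rewrite rmorphM !realification_normE normrZ.
by congr (_ * _); rewrite [RHS]RRe_real ?normr_real.
Qed.

Lemma realification_normi x : `|'i *: x : XR| = `|x : XR|.
Proof.
rewrite realification_normZ normc_def/= expr0n/= expr1n add0r sqrtr1.
by rewrite mul1r.
Qed.

Variable tau : X -> X.
Hypothesis tau_conj : conjugation tau.

Let tauD x y : tau (x + y) = tau x + tau y. Proof. by case: tau_conj. Qed.
Let tauZ a x : tau (a *: x) = conjc a *: tau x. Proof. by case: tau_conj. Qed.
Let tau_norm x : `|tau x| = `|x|. Proof. by case: tau_conj. Qed.
Let tauK x : tau (tau x) = x. Proof. by case: tau_conj. Qed.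

Definition real_vector (x : XR) : Prop := tau x = x.

Lemma real_vectorD (x y : XR) :
  real_vector x -> real_vector y -> real_vector (x + y).
Proof. by rewrite /real_vector tauD => -> ->. Qed.

Lemma real_vectorZ (a : R) (x : XR) : real_vector x -> real_vector (a *: x).
Proof. by rewrite /real_vector realification_scaleE tauZ [conjc _]conjc_real => ->. Qed.

Let mean_norm x : `|2^-1 *: (x + tau x)| <= `|x|.
Proof.
rewrite normrZ gtr0_norm ?invr_gt0// mulrC ler_pdivrMr//.
by apply: (le_trans (ler_normD _ _)); rewrite tau_norm mulr_natr mulr2n.
Qed.

(** For [x] and [y] fixed by the conjugation, the real part of [x + (a + i b) y]
    is [x + a y], and taking real parts does not increase norms. *)
Lemma real_birkhoff_complex (x y : XR) : real_vector x -> real_vector y ->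
  real_birkhoff x y -> birkhoff_orthogonal (x : X) (y : X).
Proof.
move=> tx ty xy [a b]; set z := _ + _.
apply: le_trans (mean_norm z).
have -> : 2^-1 *: (z + tau z) = (x : X) + a%:C *: (y : X).
  have x2 : (x : X) + (x : X) = (2 : R[i]) *: (x : X).
    by rewrite scaler_nat mulr2n.
  rewrite /z tauD tauZ tx ty addrACA -scalerDl x2.
  rewrite scalerDr !scalerA mulVf ?pnatr_eq0// scale1r; congr (_ + _ *: _).
  have -> : (a +i* b) + conjc (a +i* b) = 2 * a%:C.
    rewrite mulr_natl mulr2n; apply/eqP.
    by rewrite eq_complex/= subrr addr0 !eqxx.
  by rewrite mulKf// pnatr_eq0.
by have := xy a; rewrite -lecR !realification_normE.
Qed.

(** [y] is the real part of [- i z], hence the bound on its norm. *)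
Lemma real_vector_decomp (z : X) : exists x y : XR,
  [/\ real_vector x, real_vector y, z = (x : X) + 'i *: (y : X),
      `|x| <= `|z : XR| & `|y| <= `|z : XR|].
Proof.
have norm_re w : `|2^-1 *: (w + tau w) : XR| <= `|w : XR|.
  by rewrite -lecR !realification_normE.
have re w : real_vector (2^-1 *: (w + tau w)).
  have half : (2 : R[i])^-1 = (2^-1 : R)%:C by rewrite fmorphV rmorph_nat.
  by rewrite /real_vector tauZ tauD tauK (addrC w) half [conjc _]conjc_real.
exists (2^-1 *: (z + tau z)), (2^-1 *: (- 'i *: z + tau (- 'i *: z))).
split=> //.
  have ii : 'i * 'i = -1 :> R[i] by rewrite -expr2 sqr_i.
  have ci : conjc (- 'i) = 'i :> R[i].
    by apply/eqP; rewrite eq_complex/= oppr0 opprK !eqxx.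
  rewrite tauZ ci scalerA (mulrC 'i) -scalerA -scalerDr (scalerDr 'i) !scalerA.
  rewrite mulrN ii opprK scale1r scaleN1r addrACA subrr addr0 -mulr2n.
  by rewrite -[z *+ 2]scaler_nat scalerA mulVf ?pnatr_eq0// scale1r.
apply: (le_trans (norm_re _)).
by rewrite scaleNr normrN realification_normi.
Qed.

(** If all fixed vectors were real multiples of [x], then [X] would be the
    complex line through [x]. *)
Lemma real_vector_dim (x : XR) : dim_ge X 2 -> real_vector x ->
  exists2 y : XR, real_vector y & forall r, y <> r *: x.
Proof.
move=> [v vI] xr; apply: contrapT => H.
have all_mul (y : XR) : real_vector y -> exists r : R, y = r *: x.
  move=> yr; apply: contrapT => K; apply: H; exists y => // r yE.
  by apply: K; exists r.
have all_cmul (z : X) : exists c : R[i], z = c *: (x : X).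
  have [z1 [z2 [/all_mul[r1 ->] /all_mul[r2 ->] -> _ _]]] := real_vector_decomp z.
  by exists (r1%:C + 'i * r2%:C); rewrite scalerDl -scalerA.
have [c0 v0] := all_cmul (v ord0).
have [c1 v1] := all_cmul (v ord_max).
(* [- c1 v0 + c0 v1 = 0], as both vectors are multiples of [x] *)
pose c i : R[i] := if i == ord0 :> 'I_2 then - c1 else c0.
have c_eq0 : c0 = 0.
  apply: (vI c _ ord_max); rewrite big_ord_recr big_ord1/=.
  rewrite (_ : widen_ord _ _ = ord0); last exact: val_inj.
  by rewrite v0 v1 /c/= !scalerA mulNr scaleNr mulrC addNr.
have := vI (fun i => (i == ord0)%:R) _ ord0.
rewrite big_ord_recr big_ord1/= (_ : widen_ord _ _ = ord0); last exact: val_inj.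
rewrite v0 c_eq0 scale0r scaler0 scale0r addr0 => /(_ erefl)/eqP.
by rewrite oner_eq0.
Qed.
End ComplexNorm.

(** * Additive maps preserving complex orthogonality *)

Section ConjugationBirkhoff.
Variables (R : realType) (X Y : normedModType R[i]) (tau : X -> X).
Local Notation XR := (realification X).
Local Notation YR := (realification Y).
Hypotheses (dimX : dim_ge X 2) (tau_conj : conjugation tau).

Let real_vectors := @real_vector R X tau.

(** The restriction of [twist a A] to the fixed vectors of the conjugation is
    [A] on the rotated real part [a S], to which the results on real
    orthogonality apply. *)
Definition twist (a : R[i]) (A : X -> Y) : XR -> YR := fun x => A (a *: (x : X)).

Section Twists.
Variable A : X -> Y.
Hypotheses (A_additive : additive_map A) (A_birkhoff : preserves_birkhoff A).

Let A0 : A 0 = 0.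
Proof. by apply: (addIr (A 0)); rewrite -A_additive !add0r. Qed.

Let AB x y : A (x - y) = A x - A y.
Proof. by apply: (addIr (A y)); rewrite -A_additive !subrK. Qed.

Lemma twist_zmod_morphism a : zmod_morphism (twist a A).
Proof. by move=> x y; rewrite /twist scalerBr AB. Qed.

Lemma twist_birkhoff a x y : real_vectors x -> real_vectors y ->
  real_birkhoff x y -> real_birkhoff (twist a A x) (twist a A y).
Proof.
move=> xr yr /(real_birkhoff_complex tau_conj xr yr) xy.
exact/birkhoff_orthogonal_real/A_birkhoff/birkhoff_orthogonalZ.
Qed.

Definition twist_additive a : {additive XR -> YR} :=
  HB.pack (twist a A) (GRing.isZmodMorphism.Build _ _ _ (twist_zmod_morphism a)).

Lemma twist_homogeneous a (r : R) (x : XR) : real_vectors x ->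
  twist a A (r *: x) = r *: twist a A x.
Proof.
exact: (additive_birkhoff_homogeneous (@real_vectorD _ _ _ tau_conj)
  (@real_vectorZ _ _ _ tau_conj) (A := twist_additive a)
  (@twist_birkhoff a) (fun x => real_vector_dim tau_conj dimX)).
Qed.

Lemma twist_comparable a (x y : XR) : real_vectors x -> real_vectors y ->
  `|twist a A x| * `|y| <= 12 * (`|twist a A y| * `|x|).
Proof.
exact: (additive_birkhoff_comparable (@real_vectorD _ _ _ tau_conj)
  (@real_vectorZ _ _ _ tau_conj) (A := twist_additive a)
  (@twist_birkhoff a) (fun x => real_vector_dim tau_conj dimX)).
Qed.

Lemma additive_birkhoff_real_linear : real_linear A.
Proof.
move=> r z z'; rewrite [LHS]A_additive; congr (_ + _).
have [x [y [xr yr -> _ _]]] := real_vector_decomp tau_conj z.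
have Ax := twist_homogeneous 1 r xr; have Ay := twist_homogeneous 'i r yr.
rewrite /twist !scale1r in Ax; rewrite /twist in Ay.
rewrite [A (_ + 'i *: _)]A_additive [RHS]scalerDr -Ax -Ay [_ *: (_ + _)]scalerDr.
rewrite [LHS]A_additive; congr (_ + A _).
by rewrite !realification_scaleE !scalerA mulrC.
Qed.

Lemma real_vector_neq0 : exists2 x : XR, real_vectors x & 0 < `|x|.
Proof.
have [z [_ [zr _ _ _ _]]] := real_vector_decomp tau_conj 0.
have r0 : real_vectors 0 by rewrite -(scale0r z); exact: real_vectorZ.
have [x xr x0] := real_vector_dim tau_conj dimX r0.
exists x => //; rewrite normr_gt0; apply/eqP => xE.
by apply: (x0 0); rewrite xE scaler0.
Qed.

Lemma additive_birkhoff_bounded :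
  exists M : R, forall z : XR, `|A z : YR| <= M * `|z|.
Proof.
have [x0 x0r nx0] := real_vector_neq0.
pose M a := 12 * `|twist a A x0| / `|x0|.
have MP a (x : XR) : real_vectors x -> `|twist a A x| <= M a * `|x|.
  move=> xr; rewrite /M mulrAC ler_pdivlMr// -mulrA.
  exact: twist_comparable.
have M0 a : 0 <= M a by rewrite divr_ge0 ?mulr_ge0.
exists (M 1 + M 'i) => z.
have [x [y [xr yr zE xz yz]]] := real_vector_decomp tau_conj z.
rewrite {1}zE A_additive mulrDl; apply: (le_trans (ler_normD _ _)).
apply: lerD.
- have := MP 1 x xr; rewrite /twist scale1r => /le_trans; apply.
  exact: ler_wpM2l.
- by apply: (le_trans (MP 'i y yr)); exact: ler_wpM2l.
Qed.

Hypothesis A_inj : forall x, A x = 0 -> x = 0.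

(** Adding to [(1 + i s) x] a vector to which it is orthogonal gives
    [x + i y], so it is enough to bound [A ((1 + i s) x)] below uniformly in
    [s] and in [x] of norm 1; comparability reduces this to a single [x]. *)
Lemma additive_birkhoff_re_bound : exists2 c : R, 0 < c &
  forall x y : XR, real_vectors x -> real_vectors y ->
    c * `|x| <= `|A ((x : X) + 'i *: (y : X)) : YR|.
Proof.
have [x0 x0r nx0] := real_vector_neq0.
have sE (s : R) : 1 +i* s = 1 + 'i * s%:C :> R[i].
  by rewrite [LHS]complexE mulrC.
have Aline (s : R) : A ((1 +i* s) *: (x0 : X)) =
    A x0 + s *: (A ('i *: (x0 : X)) : YR) :> YR.
  have := twist_homogeneous 'i s x0r.
  rewrite /twist realification_scaleE scalerA => <-.
  by rewrite -[RHS](A_additive x0 _) sE scalerDl scale1r.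
have [s As|c c0 cP] := @line_norm_ge R YR (A ('i *: (x0 : X))) (A x0).
  have : A ((1 +i* (- s)) *: (x0 : X)) = 0 by rewrite Aline As scaleNr subrr.
  move=> /A_inj/eqP; rewrite scaler_eq0 => /orP[|/eqP x00].
    by rewrite eq_complex/= oner_eq0.
  by move: nx0; rewrite x00 normr0 ltxx.
exists (c / (12 * `|x0|)) => [|x y xr yr]; first by rewrite divr_gt0// mulr_gt0.
have [s xs] := real_birkhoff_exists x y.
set w := y - s *: x in xs.
have wr : real_vectors w.
  by rewrite /w -scaleNr; apply: real_vectorD => //; exact: real_vectorZ.
have zE : (x : X) + 'i *: (y : X) = (1 +i* s) *: (x : X) + 'i *: (w : X).
  rewrite /w realification_scaleE scalerBr scalerA sE scalerDl scale1r.
  by rewrite -addrA; congr (_ + _); rewrite addrC subrK.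
have le1 : `|A ((1 +i* s) *: (x : X)) : YR| <= `|A ((x : X) + 'i *: (y : X)) : YR|.
  rewrite zE A_additive; apply: birkhoff_norm_le; apply: A_birkhoff.
  exact/birkhoff_orthogonalZ/(real_birkhoff_complex tau_conj).
have := twist_comparable (1 +i* s) x0r xr; rewrite /twist => cmp.
have := cP s; rewrite -Aline => cA.
rewrite mulrAC ler_pdivrMr ?mulr_gt0//.
have := ler_wpM2r (normr_ge0 x) cA.
have := ler_wpM2r (ltW nx0) le1; lra.
Qed.

End Twists.

Lemma additive_birkhoff_bounded_below (A : X -> Y) :
  additive_map A -> preserves_birkhoff A -> (forall x, A x = 0 -> x = 0) ->
  exists K : R, forall z : XR, `|z| <= K * `|A z : YR|.
Proof.
move=> A_additive A_birkhoff A_inj.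
have [c c0 cP] := additive_birkhoff_re_bound A_additive A_birkhoff A_inj.
pose B x := A ('i *: x).
have B_additive : additive_map B by move=> x y; rewrite /B scalerDr A_additive.
have B_birkhoff : preserves_birkhoff B.
  by move=> x y xy; apply/A_birkhoff/birkhoff_orthogonalZ.
have B_inj x : B x = 0 -> x = 0.
  by move=> /A_inj/eqP; rewrite scaler_eq0 eq_complex/= oner_eq0 andbF => /eqP.
(* [B (y - i x) = A (x + i y)], so the bound for [B] is one for the imaginary
   part *)
have [d d0 dP] := additive_birkhoff_re_bound B_additive B_birkhoff B_inj.
exists (c^-1 + d^-1) => z.
have [x [y [xr yr zE _ _]]] := real_vector_decomp tau_conj z.
have {}cP := cP x y xr yr; rewrite -zE in cP.
have yxE : 'i *: ((y : X) + 'i *: (- x : X)) = z.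
  by rewrite scalerDr scalerA -expr2 sqr_i scaleN1r opprK addrC zE.
have xNr : real_vectors (- x) by rewrite -scaleN1r; exact: real_vectorZ.
have {}dP := dP y (- x) yr xNr; rewrite /B yxE in dP.
rewrite mulrDl; apply: le_trans (lerD _ _); last first.
- by rewrite mulrC ler_pdivlMr// mulrC; exact: dP.
- by rewrite mulrC ler_pdivlMr// mulrC; exact: cP.
by rewrite zE -[X in _ <= _ + X]realification_normi; exact: ler_normD.
Qed.

End ConjugationBirkhoff.

(** * Bounded linear bijections and the theorem *)

Lemma lipschitz_continuous (R : realType) (V W : normedModType R) (f : V -> W)
    (k : R) : (forall x y, `|f x - f y| <= k * `|x - y|) -> continuous f.
Proof.
move=> fk x; apply/cvgrPdist_lt => e e0.
have k0 : 0 < `|k| + 1 by rewrite ltr_wpDl.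
have d0 : 0 < e / (`|k| + 1) by rewrite divr_gt0.
near=> y.
have xy : `|x - y| < e / (`|k| + 1) by near: y; exact: cvgr_dist_lt.
apply: (le_lt_trans (fk x y)); move: xy; rewrite ltr_pdivlMr// mulrC.
apply: le_lt_trans; apply: ler_wpM2r => //.
by rewrite (le_trans (ler_norm k))// lerDl.
Unshelve. all: by end_near. Qed.

Lemma linear_bounded_isomorphism (R : realType) (V W : normedModType R)
    (f : V -> W) (M K : R) : linear f -> surjective_map f ->
  (forall x, `|f x| <= M * `|x|) -> (forall x, `|x| <= K * `|f x|) ->
  isomorphism f.
Proof.
move=> f_lin f_surj fM fK.
have fB x y : f (x - y) = f x - f y.
  by rewrite addrC -scaleN1r f_lin scaleN1r addrC.
have [g gK] := choice f_surj.
have fg_cancel : cancel f g.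
  move=> x; apply/eqP; rewrite -subr_eq0 -normr_le0.
  by apply: (le_trans (fK _)); rewrite fB gK subrr normr0 mulr0.
split=> //; first by apply: (@lipschitz_continuous _ _ _ _ M) => x y; rewrite -fB.
exists g; split=> //; apply: (@lipschitz_continuous _ _ _ _ K) => x y.
by apply: (le_trans (fK _)); rewrite fB !gK.
Qed.

Theorem proposition2p2 (R : realType) (X Y : normedModType R[i])
    (dimX : dim_ge X 2) (tau : X -> X) (tau_conj : conjugation tau)
    (A : X -> Y) (A_additive : additive_map A)
    (A_birkhoff : preserves_birkhoff A) :
  real_linear A /\
  (surjective_map A -> preserves_birkhoff_both A ->
   real_linear_isomorphism A /\
   isomorphic (realification X) (realification Y)).
Proof.
have A_lin := additive_birkhoff_real_linear dimX tau_conj A_additive A_birkhoff.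
split=> // A_surj A_both.
have A_inj x : A x = 0 -> x = 0.
  (* only the zero vector is orthogonal to itself *)
  move=> Ax0; have xx : birkhoff_orthogonal x x.
    by apply/A_both => a; rewrite Ax0 scaler0 addr0.
  by have := xx (-1); rewrite scaleN1r subrr normr0 normr_le0 => /eqP.
have [M AM] := additive_birkhoff_bounded dimX tau_conj A_additive A_birkhoff.
have [K AK] :=
  additive_birkhoff_bounded_below dimX tau_conj A_additive A_birkhoff A_inj.
have A_iso : real_linear_isomorphism A.
  exact: linear_bounded_isomorphism A_lin A_surj AM AK.
by split=> //; exists A.
Qed.
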